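(* A graph $G$ is connected if and only if $G$ can be constructed from $K_1$ by successively adding open or closed $H$-edges to subgraphs $H$ which have already been constructed; that is, if and only if there is a finite sequence of graphs $H_0,H_1,\dots,H_m$ with $H_0$ a one-vertex graph (a copy of $K_1$), $H_m=G$, and, for each $k=0,\dots,m-1$, $H_{k+1}=H_k\cup ab$ for some $ab$ that is an open $H_k$-edge or a closed $H_k$-edge.
   Context: All graphs are simple (no loops, no multiple edges), undirected and finite; the smallest connected graph is $K_1=(\{v\},\{\})$ (graphs have at least one vertex). For graphs $G,H$, $G\cup H=(V_G\cup V_H,E_G\cup E_H)$ and $G\cap H=(V_G\cap V_H,E_G\cap E_H)$. For distinct $a,b$, $ab$ also denotes the graph $(\{a,b\},\{ab\})$, so $H\cup ab=(V_H\cup\{a,b\},E_H\cup\{ab\})$. Given a graph $H=(V_H,E_H)$, $ab$ is called a closed $H$-edge if $ab\cap H=(\{a,b\},\{\})$ (both $a,b\in V_H$ and $ab\notin E_H$), and an open $H$-edge if $ab\cap H=(\{a\},\{\})$ or, equivalently up to renaming, $ab\cap H=(\{b\},\{\})$ (exactly one of $a,b$ lies in $V_H$). *)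

(* Defs.v *)
From mathcomp Require Import all_boot.
From mathcomp Require Export finmap.

Set Implicit Arguments.
Unset Strict Implicit.
Unset Printing Implicit Defensive.

Local Open Scope fset_scope.

(* Vertices of all graphs are drawn from one ambient choiceType [K], so that
   unions and intersections of graphs with different vertex sets make sense.
   A pair (V, E) need not be a graph: the intersection of two graphs can have
   no vertex, although a graph has at least one. *)
Record pregraph (K : choiceType) := Pregraph {
  vset : {fset K};
  eset : {fset {fset K}}
}.

Definition is_graph (K : choiceType) (G : pregraph K) : bool :=
  (vset G != fset0) &&
  all (fun e : {fset K} => (#|` e| == 2) && (e `<=` vset G)) (eset G).

Record graph (K : choiceType) := Graph {
  pregraph_of :> pregraph K;
  graphP : is_graph pregraph_of
}.

Definition gunion (K : choiceType) (G H : pregraph K) : pregraph K :=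
  Pregraph (vset G `|` vset H) (eset G `|` eset H).

Definition ginter (K : choiceType) (G H : pregraph K) : pregraph K :=
  Pregraph (vset G `&` vset H) (eset G `&` eset H).

Definition one_vertex (K : choiceType) (v : K) : pregraph K :=
  Pregraph [fset v] fset0.

(* The graph ab; meaningful only for a != b. *)
Definition edge_graph (K : choiceType) (a b : K) : pregraph K :=
  Pregraph [fset a; b] [fset [fset a; b]].

Definition closed_edge (K : choiceType) (H : pregraph K) (a b : K) : Prop :=
  a != b /\ ginter (edge_graph a b) H = Pregraph [fset a; b] fset0.

Definition open_edge (K : choiceType) (H : pregraph K) (a b : K) : Prop :=
  a != b /\
  (ginter (edge_graph a b) H = Pregraph [fset a] fset0 \/
   ginter (edge_graph a b) H = Pregraph [fset b] fset0).

Definition adjacent (K : choiceType) (G : pregraph K) : rel K :=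
  fun x y => [fset x; y] \in eset G.

Definition connected (K : choiceType) (G : graph K) : Prop :=
  forall x y : K, x \in vset G -> y \in vset G ->
  exists p : seq K,
    [/\ path (adjacent G) x p, last x p = y & uniq (x :: p)].

(* Main.v *)
(** A crossing argument: if [H] is a constructible proper subgraph of a connected
    graph [G], then either some vertex of [G] is missing from [H], and a path of
    [G] from [H] to that vertex must leave [H] along an open [H]-edge, or only
    edges are missing, and each of them is a closed [H]-edge. Adding that edge
    keeps [H] inside [G], and this can happen at most [#|` eset G|] times.
    Conversely, an open or closed [H]-edge always has an endpoint in [H], to
    which its other endpoint gets joined. *)
Require Import Defs.
From mathcomp Require Import all_boot finmap.

Local Open Scope fset_scope.

Section Graphs.
Variable K : choiceType.
Implicit Types (G H : graph K) (a b x y : K).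

(** * Graphs, and open and closed edges in terms of membership *)

Lemma graph_inj G H : pregraph_of G = pregraph_of H -> G = H.
Proof.
case: G H => [G gG] [H gH] /= eGH.
by subst H; rewrite (bool_irrelevance gG gH).
Qed.

Lemma edgeP G e :
  e \in eset G ->
  exists a b, [/\ a != b, e = [fset a; b], a \in vset G & b \in vset G].
Proof.
have /andP[_ /allP gG] := graphP G.
move=> /gG /andP[card_e /fsubsetP sub].
have /fset0Pn[a ae] : e != fset0 by rewrite -cardfs_eq0 (eqP card_e).
move: card_e; rewrite (cardfsD1 a) ae eqSS => /cardfs1P[b eDa].
have := fset11 b; rewrite -eDa !inE => /andP[ba be].
by exists a, b; rewrite eq_sym ba -eDa fsetD1K ?sub.
Qed.

Lemma edge_subset G e x : e \in eset G -> x \in e -> x \in vset G.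
Proof.
by move=> /edgeP[a [b [_ -> aG bG]]]; rewrite !inE => /orP[] /eqP->.
Qed.

Lemma adjacent_sym (G : pregraph K) : symmetric (adjacent G).
Proof. by move=> x y; rewrite /adjacent fsetUC. Qed.

Lemma is_graph_one_vertex (v : K) : is_graph (one_vertex v).
Proof.
apply/andP; split; last by apply/allP => e; rewrite inE.
by apply/fset0Pn; exists v; rewrite inE.
Qed.

Lemma is_graph_add_edge H a b : a != b -> is_graph (gunion H (edge_graph a b)).
Proof.
move=> ab; have /andP[/fset0Pn[v vH] /allP gH] := graphP H.
apply/andP; split=> /=; first by apply/fset0Pn; exists v; rewrite inE vH.
apply/allP => e; rewrite !inE => /orP[/gH/andP[-> eH]|/eqP->].
  by rewrite (fsubset_trans eH) ?fsubsetUl.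
by rewrite cardfs2 ab fsubsetUr.
Qed.

Lemma open_edge_intro H a b : a \in vset H -> b \notin vset H -> open_edge H a b.
Proof.
move=> aH bNH; split; first by apply: contraNneq bNH => <-.
left; rewrite /ginter /=; congr Pregraph; apply/fsetP => x; rewrite !inE.
  case: (x =P a) => [->|_] /=; first by rewrite aH.
  by case: (x =P b) => // ->; apply: negbTE.
(* If [ab] were an edge of [H], its endpoint [b] would be a vertex of [H]. *)
apply/negP => /andP[/eqP-> /edge_subset/(_ (fset22 _ _))].
exact/negP.
Qed.

Lemma closed_edge_intro H a b :
    a != b -> a \in vset H -> b \in vset H -> [fset a; b] \notin eset H ->
  closed_edge H a b.
Proof.
move=> ab aH bH abNH; split=> //.
rewrite /ginter /=; congr Pregraph; apply/fsetP => x; rewrite !inE.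
  by case: (x =P a) => [->|_] /=; [rewrite aH | case: (x =P b) => // ->].
by case: eqP => // ->; apply: negbTE.
Qed.

Lemma edge_endpoint H a b :
  open_edge H a b \/ closed_edge H a b -> a \in vset H \/ b \in vset H.
Proof.
case=> [[_ [] [/fsetP e _]]|[_ [/fsetP e _]]].
- by left; have := e a; rewrite !inE eqxx /= => ->.
- by right; have := e b; rewrite !inE eqxx orbT /= => ->.
- by left; have := e a; rewrite !inE eqxx /= => ->.
Qed.

(** * Walks and connectedness *)

Definition walk_connected (G : pregraph K) x y :=
  exists2 p, path (adjacent G) x p & last x p = y.

Lemma walk_connected_trans (G : pregraph K) x y z :
  walk_connected G x y -> walk_connected G y z -> walk_connected G x z.
Proof.
move=> [p pp <-] [q pq <-]; exists (p ++ q); last by rewrite last_cat.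
by rewrite cat_path pp.
Qed.

Lemma walk_connected_sym (G : pregraph K) x y :
  walk_connected G x y -> walk_connected G y x.
Proof.
move=> [p pp <-]; exists (rev (belast x p)).
  by rewrite rev_path (eq_path (e' := adjacent G)) // => ? ?; rewrite adjacent_sym.
by case: p pp => //= z p _; rewrite rev_cons last_rcons.
Qed.

Lemma walk_connected_adjacent (G : pregraph K) x y :
  adjacent G x y -> walk_connected G x y.
Proof. by move=> xy; exists [:: y] => //=; rewrite xy. Qed.

Lemma walk_connected_sub (G G' : pregraph K) x y :
  eset G `<=` eset G' -> walk_connected G x y -> walk_connected G' x y.
Proof.
move=> /fsubsetP sub [p pp <-]; exists p => //.
by apply: sub_path pp => u v /sub.
Qed.

Lemma connectedP G :
  connected G <-> {in vset G &, forall x y, walk_connected G x y}.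
Proof.
split=> [cG x y xG yG | cG x y xG yG].
  by have [p [pp lp _]] := cG x y xG yG; exists p.
have [p pp <-] := cG x y xG yG.
by case: (shortenP pp) => q pq uq _; exists q.
Qed.

(** * Constructible graphs are connected *)

Definition adds_edge H (H' : graph K) : Prop :=
  exists a b, (open_edge H a b \/ closed_edge H a b) /\
    pregraph_of H' = gunion H (edge_graph a b).

Definition constructible G : Prop :=
  exists (m : nat) (H : nat -> graph K),
    [/\ exists v : K, pregraph_of (H 0) = one_vertex v, H m = G &
        forall k : nat, k < m -> adds_edge (H k) (H k.+1)].

Lemma connected_one_vertex G (v : K) : pregraph_of G = one_vertex v -> connected G.
Proof.
move=> eG; apply/connectedP => x y; rewrite eG !inE => /eqP-> /eqP->.
by exists [::].
Qed.

(** An endpoint [v] of [ab] lying in [H] serves as a hub: old vertices reach it inside [H], and [a]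
    and [b] reach it along the new edge. Any two vertices are then joined through [v]. *)
Lemma connected_add_edge H H' : adds_edge H H' -> connected H -> connected H'.
Proof.
move=> [a [b [/edge_endpoint abH eH']]] /connectedP cH.
have subE : eset H `<=` eset H' by rewrite eH' fsubsetUl.
have ab : walk_connected H' a b.
  by apply: walk_connected_adjacent; rewrite /adjacent eH' !inE eqxx orbT.
have [v vH toab] : exists2 v, v \in vset H
    & forall x, x \in [fset a; b] -> walk_connected H' v x.
  case: abH => vH; [exists a | exists b] => // x;
    rewrite !inE => /orP[] /eqP-> //; try by exists [::].
  exact: walk_connected_sym.
have to x : x \in vset H' -> walk_connected H' v x.
  rewrite {1}eH' in_fsetU => /orP[xH|]; last exact: toab.
  exact: walk_connected_sub subE (cH v x vH xH).
apply/connectedP => x y /to vx /to; apply: walk_connected_trans.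
exact: walk_connected_sym.
Qed.

Lemma constructible_connected G : constructible G -> connected G.
Proof.
move=> [m [H [[v H0] <- step]]].
suff: forall k, k <= m -> connected (H k) by apply.
elim=> [|k IH] km; first exact: connected_one_vertex H0.
exact: connected_add_edge (step k km) (IH (ltnW km)).
Qed.

(** * Connected graphs are constructible *)

Lemma constructible_one_vertex G (v : K) :
  pregraph_of G = one_vertex v -> constructible G.
Proof. by move=> eG; exists 0, (fun=> G); split=> //; exists v. Qed.

Lemma constructible_add_edge H H' :
  constructible H -> adds_edge H H' -> constructible H'.
Proof.
move=> [m [F [F0 Fm step]]] HH'.
exists m.+1, (fun k => if k <= m then F k else H').
split=> //; first by rewrite ltnn.
move=> k; rewrite ltnS => km; rewrite km.
(* Only [k = m] is a new step: it leads from [F m], which is [H], to [H']. *)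
by case: ltngtP km => // [km _|-> _]; [apply: step | rewrite Fm].
Qed.

(** Induction along the path finds its first vertex outside [A], taken as [b], with its predecessor
    as [a]. *)
Lemma path_crossing (e : rel K) (A : {fset K}) x p :
    path e x p -> x \in A -> last x p \notin A ->
  exists a b, [/\ a \in A, b \notin A & e a b].
Proof.
elim: p x => [|y p IH] x /=; first by move=> _ ->.
case/andP=> xy yp xA lA; case: (boolP (y \in A)) => yA; first exact: IH yp yA lA.
by exists x, y.
Qed.

(** The last two conjuncts serve the later induction: [ab] being in [G] keeps the enlarged graph
    inside [G], and its absence from [H] guarantees progress. *)
Lemma connected_missing_edge G H :
    connected G -> vset H `<=` vset G -> eset H `<=` eset G ->
  H = G \/ exists a b, [/\ open_edge H a b \/ closed_edge H a b,
    [fset a; b] \in eset G & [fset a; b] \notin eset H].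
Proof.
move=> /connectedP cG subV subE.
case: (boolP (vset G `<=` vset H)) => [VGH|/fsubsetPn[y yG yNH]]; last first.
  have /andP[/fset0Pn[x xH] _] := graphP H.
  have [p pp lp] := cG x y (fsubsetP subV x xH) yG.
  rewrite -lp in yNH; have [a [b [aH bNH ab]]] := path_crossing _ _ _ _ pp xH yNH.
  right; exists a, b; split=> //; first by left; apply: open_edge_intro.
  by apply: contra bNH => /edge_subset; apply; rewrite fset22.
case: (boolP (eset G `<=` eset H)) => [EGH|/fsubsetPn[e eG eNH]].
  have eV : vset H = vset G by apply/eqP; rewrite eqEfsubset subV.
  have eE : eset H = eset G by apply/eqP; rewrite eqEfsubset subE.
  left; apply: graph_inj; move: eV eE.
  by case: (pregraph_of H) (pregraph_of G) => [? ?] [? ?] /= -> ->.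
have [a [b [ab eab aG bG]]] := edgeP _ _ eG.
right; exists a, b; rewrite -eab; split=> //; right.
by apply: closed_edge_intro; rewrite -?eab //; apply: fsubsetP VGH _ _.
Qed.

(** Induction on the number of edges of [G] still missing from [H]. *)
Lemma constructible_supergraph G H :
    connected G -> vset H `<=` vset G -> eset H `<=` eset G ->
  constructible H -> constructible G.
Proof.
move=> cG; have [n] := ubnP #|` eset G `\` eset H|.
elim: n H => // n IH H; rewrite ltnS => le_n subV subE cH.
have [<-//|[a [b [abH abG abNH]]]] := connected_missing_edge _ _ cG subV subE.
(* Both kinds of edge include this condition, without which adding [ab] need not give a graph. *)
have ab : a != b by case: abH => [[]|[]].
pose H' := Graph (is_graph_add_edge H a b ab).
have subE' : eset H' `<=` eset G by rewrite fsubUset subE fsub1set.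
apply: (IH H') => //.
- apply: leq_trans le_n; apply: fproper_ltn_card.
  rewrite /fproper fsetDS ?fsubsetUl // andTb.
  (* The edge [ab] was missing from [H] and no longer is, so the measure drops strictly. *)
  by apply/fsubsetPn; exists [fset a; b]; rewrite !inE ?abNH ?abG // eqxx orbT.
- rewrite fsubUset subV; apply/fsubsetP => x.
  exact: edge_subset abG.
- by apply: constructible_add_edge cH _; exists a, b.
Qed.

Lemma connected_constructible G : connected G -> constructible G.
Proof.
move=> cG; have /andP[/fset0Pn[v vG] _] := graphP G.
(* The construction may start at any vertex of [G]; one exists because graphs are nonempty. *)
apply: (constructible_supergraph _ (Graph (is_graph_one_vertex v))) => //=.
- by rewrite fsub1set.
- exact: constructible_one_vertex.
Qed.

End Graphs.

Theorem lemma3p2 (K : choiceType) (G : graph K) :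
  connected G <->
  exists (m : nat) (H : nat -> graph K),
    [/\ exists v : K, pregraph_of (H 0) = one_vertex v,
        H m = G &
        forall k : nat, k < m ->
          exists a b : K,
            (open_edge (H k) a b \/ closed_edge (H k) a b) /\
            pregraph_of (H k.+1) = gunion (H k) (edge_graph a b)].
Proof.
split; [exact: connected_constructible | exact: constructible_connected].
Qed.
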